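(* If $n>2$ is an integer, then $$\frac{n^3}{n-1}\le\lambda_n\le\frac{n^3}{n-2}.$$
   Context: For an integer $n\ge 3$, the best constant $\lambda_n$ is the maximal real number $\lambda>0$ such that the inequality $$\sum_{i=1}^n\frac{1}{x_i}\ \ge\ \frac{\lambda}{1+n^{n-2}(\lambda-n^2)\prod_{i=1}^n x_i}$$ holds for all real $x_1,\ldots,x_n>0$ with $\sum_{i=1}^n x_i=1$. *)

(* Defs.v *)
From mathcomp Require Import all_boot all_order all_algebra.
From mathcomp Require Import classical_sets reals.

Set Implicit Arguments.
Unset Strict Implicit.
Unset Printing Implicit Defensive.

Import Order.TTheory GRing.Theory Num.Theory.

Local Open Scope classical_set_scope.
Local Open Scope ring_scope.

(* The denominator never vanishes where it matters: for lambda > 0 it is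
   positive, since prod_i x_i <= n^-n by the AM-GM inequality. *)
Definition inequality_holds (R : realType) (n : nat) (lambda : R) : Prop :=
  forall x : 'I_n -> R,
    (forall i, 0 < x i) -> \sum_(i < n) x i = 1 ->
    lambda / (1 + n%:R ^+ (n - 2)%N * (lambda - n%:R ^+ 2) * \prod_(i < n) x i)
      <= \sum_(i < n) (x i)^-1.

Definition admissible (R : realType) (n : nat) : set R :=
  [set lambda | 0 < lambda /\ inequality_holds n lambda].

(* The greatest element of [admissible n] in [R].  If there were none, [xget] would
   return the default value 0, so a positive lower bound on
   [best_constant R n] entails that the maximum exists. *)
Definition best_constant (R : realType) (n : nat) : R :=
  xget 0 [set lambda | admissible n lambda /\
                       ubound (admissible n) lambda].

(* Main.v *)
Require Import Defs.
From mathcomp Require Import all_boot all_order all_algebra.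
From mathcomp Require Import classical_sets reals.
From mathcomp Require Import ring lra.

Set Implicit Arguments.
Unset Strict Implicit.
Unset Printing Implicit Defensive.

Import Order.TTheory GRing.Theory Num.Theory.

Local Open Scope ring_scope.

(** The whole statement is read off the cleared form of the inequality,
    [lambda * (1 - n^(n-2) P S) <= S * (1 - n^n P)], where [P] is the product
    of the [x i] and [S] the sum of their inverses: the denominator is positive
    because [n^n P <= 1] by the inequality of arithmetic and geometric means.

    Lower bound.  For [lambda = n^3 / (n - 1)] the cleared inequality says
    [n^3 <= S * (n - 1 + n^n P)].  Two applications of the arithmetic-geometric
    mean inequality give it: one to the [1 / x i], so that [S >= n / P^(1/n)],
    and one to [n - 1] copies of 1 together with [n^n P], so that
    [n - 1 + n^n P >= n * (n * P^(1/n))].  The roots cancel in the product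
    ([n_cube_le_invsum_mul]).

    Upper bound.  Both [1 - n^(n-2) P S] and [1 - n^n P] vanish to second order
    at the barycentre [x i = 1 / n], so the perturbation
    [(1 + t) / n, (1 - t) / n, 1 / n, ...] bounds [lambda] by the limit of
    [S (1 - n^n P) / (1 - n^(n-2) P S)] as [t] tends to 0, which is
    [n^3 / (n - 2)] ([admissible_le]).

    Existence.  The best constant is defined as a greatest element, so it must be
    shown that there is one.  For fixed [x] the cleared inequality is affine in
    [lambda], hence passes to the supremum of the admissible values
    ([admissible_sup]), which exists by the two bounds. *)

Lemma prod_le_mean_exp (R : realFieldType) (n : nat) (x : 'I_n -> R) :
  (forall i, 0 <= x i) ->
  \prod_(i < n) x i <= ((\sum_(i < n) x i) / n%:R) ^+ n.
Proof.
move=> x_ge0.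
by have [] := @leif_AGM R 'I_n predT x (fun i _ => x_ge0 i); rewrite card_ord.
Qed.

Lemma scaled_prod_le1 (R : realFieldType) (n : nat) (x : 'I_n -> R) :
  (0 < n)%N -> (forall i, 0 < x i) -> \sum_(i < n) x i = 1 ->
  n%:R ^+ n * \prod_(i < n) x i <= 1.
Proof.
move=> n_gt0 x_gt0 sum_x.
have := @prod_le_mean_exp R n x (fun i => ltW (x_gt0 i)).
rewrite sum_x div1r exprVn => le_prod.
by rewrite mulrC -ler_pdivlMr ?exprn_gt0 ?ltr0n // div1r.
Qed.

(** The arithmetic-geometric mean inequality for [n - 1] copies of 1 and one
    copy of [q]; it is Bernoulli's inequality in disguise. *)
Lemma le_mean_ones_exp (R : realFieldType) (n : nat) (q : R) :
  (0 < n)%N -> 0 <= q -> q <= ((n%:R - 1 + q) / n%:R) ^+ n.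
Proof.
case: n => // n _ q_ge0.
pose y (i : 'I_n.+1) : R := if i == ord0 then q else 1.
have y_ge0 i : 0 <= y i by rewrite /y; case: ifP.
have := @prod_le_mean_exp R n.+1 y y_ge0.
rewrite !big_ord_recl /y /= big1_eq mulr1 sumr_const card_ord.
by rewrite -[n.+1%:R]natr1 addrK addrC.
Qed.

(** Comparing [n]-th powers avoids the roots: [1 / P] is at most the [n]-th power
    of [S / n] and [n^n P] at most that of [(n - 1 + n^n P) / n], and the
    product of the left-hand sides is [n^n]. *)
Lemma n_cube_le_invsum_mul (R : realFieldType) (n : nat) (x : 'I_n -> R) :
  (0 < n)%N -> (forall i, 0 < x i) ->
  n%:R ^+ 3 <= (\sum_(i < n) (x i)^-1) *
               (n%:R - 1 + n%:R ^+ n * \prod_(i < n) x i).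
Proof.
move=> n_gt0 x_gt0.
have xV_ge0 i : 0 <= (x i)^-1 by rewrite invr_ge0 ltW.
have P_gt0 : 0 < \prod_(i < n) x i by apply: prodr_gt0.
have := @prod_le_mean_exp R n (fun i => (x i)^-1) xV_ge0.
rewrite prodfV; move: P_gt0.
have S_ge0 : 0 <= \sum_(i < n) (x i)^-1 by apply: sumr_ge0.
set P := \prod_(i < n) x i; set S := \sum_(i < n) _ in S_ge0 * => P_gt0 leS.
have nR_gt0 : 0 < n%:R :> R by rewrite ltr0n.
have n_ge1 : 1 <= n%:R :> R by rewrite ler1n.
have Q_gt0 : 0 < n%:R ^+ n * P by rewrite mulr_gt0 ?exprn_gt0.
have leQ := le_mean_ones_exp n_gt0 (ltW Q_gt0).
have PV_ge0 : 0 <= P^-1 by rewrite invr_ge0 ltW.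
have := ler_pM PV_ge0 (ltW Q_gt0) leS leQ.
rewrite mulrCA mulVf ?gt_eqF // mulr1 -exprMn ler_pXn2r //; last 2 first.
- by rewrite nnegrE ltW.
- by rewrite nnegrE mulr_ge0 // divr_ge0 ?ler0n // addr_ge0 ?subr_ge0 // ltW.
by rewrite mulrACA -invfM ler_pdivlMr ?mulr_gt0 // -!expr2 -exprS.
Qed.

Lemma inequality_holdsP (R : realType) (n : nat) (lambda : R) :
  (1 < n)%N -> 0 < lambda ->
  inequality_holds n lambda <->
  forall x : 'I_n -> R, (forall i, 0 < x i) -> \sum_(i < n) x i = 1 ->
    lambda * (1 - n%:R ^+ (n - 2) * \prod_(i < n) x i * \sum_(i < n) (x i)^-1)
      <= (\sum_(i < n) (x i)^-1) * (1 - n%:R ^+ n * \prod_(i < n) x i).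
Proof.
move=> n_gt1 lambda_gt0; have n_gt0 := ltnW n_gt1.
have equiv (x : 'I_n -> R) : (forall i, 0 < x i) -> \sum_(i < n) x i = 1 ->
  (lambda /
     (1 + n%:R ^+ (n - 2) * (lambda - n%:R ^+ 2) * \prod_(i < n) x i)
     <= \sum_(i < n) (x i)^-1) =
  (lambda * (1 - n%:R ^+ (n - 2) * \prod_(i < n) x i * \sum_(i < n) (x i)^-1)
     <= (\sum_(i < n) (x i)^-1) * (1 - n%:R ^+ n * \prod_(i < n) x i)).
  move=> x_gt0 sum_x.
  have := scaled_prod_le1 n_gt0 x_gt0 sum_x.
  have P_gt0 : 0 < \prod_(i < n) x i by apply: prodr_gt0.
  have -> : n%:R ^+ n = n%:R ^+ (n - 2) * n%:R ^+ 2 :> R.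
    by rewrite -exprD subnK.
  have N_gt0 : 0 < n%:R ^+ (n - 2) :> R by rewrite exprn_gt0 ?ltr0n.
  move: P_gt0 N_gt0; move: (\prod_(i < n) x i) (\sum_(i < n) (x i)^-1) => P S.
  move: (n%:R ^+ (n - 2)) (n%:R ^+ 2) => N m P_gt0 N_gt0 NmP_le1.
  have lNP_gt0 : 0 < lambda * (N * P) by rewrite !mulr_gt0.
  rewrite ler_pdivrMr; last by lra.
  by rewrite -subr_ge0 -[RHS]subr_ge0; congr (0 <= _); ring.
by split=> H x x_gt0 sum_x; have := H x x_gt0 sum_x; rewrite equiv.
Qed.

Lemma admissible_n_cube_div (R : realType) (n : nat) :
  (1 < n)%N -> admissible n (n%:R ^+ 3 / (n%:R - 1) : R).
Proof.
move=> n_gt1; have n_gt0 := ltnW n_gt1.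
have n1_gt0 : 0 < n%:R - 1 :> R by rewrite subr_gt0 ltr1n.
have lambda_gt0 : 0 < n%:R ^+ 3 / (n%:R - 1) :> R.
  by rewrite divr_gt0 ?exprn_gt0 ?ltr0n.
split=> //; apply/inequality_holdsP => // x x_gt0 sum_x.
have := @n_cube_le_invsum_mul R n x n_gt0 x_gt0.
have -> : n%:R ^+ n = n%:R ^+ (n - 2) * n%:R ^+ 2 :> R.
  by rewrite -exprD subnK.
move: (\prod_(i < n) x i) (\sum_(i < n) (x i)^-1) => P S.
move: (n%:R ^+ (n - 2)) => N le_cube.
rewrite mulrAC ler_pdivrMr // -subr_ge0.
move: le_cube; rewrite -subr_ge0; congr (0 <= _); ring.
Qed.

(** The test point [((1 + t) / n, (1 - t) / n, 1 / n, ..., 1 / n)] has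
    [n^n P = 1 - t^2] and [S = n * (n - 2 + 2 / (1 - t^2))]; dividing the
    cleared inequality by [t^2] leaves this bound. *)
Lemma admissible_test_point (R : realType) (n : nat) (lambda t : R) :
  (1 < n)%N -> admissible n lambda -> 0 < t -> t < 1 ->
  lambda * (n%:R - 2) <= n%:R ^+ 2 * (n%:R - 2 + 2 / (1 - t ^+ 2)).
Proof.
move=> n_gt1 [lambda_gt0 /inequality_holdsP].
move=> /(_ n_gt1 lambda_gt0); case: n n_gt1 => [|[|k]] // _ H t_gt0 t_lt1.
set nR : R := k.+2%:R in H *.
have kE : k%:R = nR - 2 by rewrite /nR -[k.+2]addn2 natrD addrK.
have nR_gt0 : 0 < nR by rewrite ltr0n.
clearbody nR.
have nR_neq0 : nR != 0 by rewrite gt_eqF.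
pose y (i : 'I_k.+2) : R :=
  if i == 0%N :> nat then 1 + t else if i == 1%N :> nat then 1 - t else 1.
have y_gt0 i : 0 < y i by rewrite /y; case: ifP => _; [|case: ifP => _]; lra.
have sumE (f : R -> R) :
    \sum_(i < k.+2) f (y i) = f (1 + t) + (f (1 - t) + (nR - 2) * f 1).
  by rewrite !big_ord_recl /y /= sumr_const card_ord -kE mulr_natl.
have prod_y : \prod_(i < k.+2) y i = 1 - t ^+ 2.
  by rewrite !big_ord_recl /y /= big1_eq; ring.
have := H (fun i => y i / nR) (fun i => divr_gt0 (y_gt0 i) nR_gt0).
rewrite (sumE (fun z => z / nR)) (sumE (fun z => (z / nR)^-1)).
have -> : \prod_(i < k.+2) (y i / nR) = (1 - t ^+ 2) / nR ^+ k.+2.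
  by rewrite big_split /= prod_y prodr_const card_ord exprVn.
have t2_gt0 : 0 < t ^+ 2 by rewrite exprn_gt0.
have d_neq0 : 1 - t ^+ 2 != 0 by nra.
have [p_neq0 m_neq0] : 1 + t != 0 /\ 1 - t != 0 by split; lra.
have N_neq0 : nR ^+ k != 0 by rewrite expf_neq0.
rewrite subn2 /=.
have -> : nR ^+ k.+2 = nR ^+ k * nR ^+ 2 by rewrite -exprD addn2.
move: (nR ^+ k) N_neq0 => N N_neq0.
set B := nR - 2 + 2 / (1 - t ^+ 2).
have -> : ((1 + t) / nR)^-1 + (((1 - t) / nR)^-1 + (nR - 2) * (1 / nR)^-1)
          = nR * B.
  by rewrite /B; field; rewrite nR_neq0 d_neq0 p_neq0 m_neq0.
have -> : 1 - N * ((1 - t ^+ 2) / (N * nR ^+ 2)) * (nR * B)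
          = t ^+ 2 * ((nR - 2) / nR).
  by rewrite /B; field; rewrite nR_neq0 N_neq0 d_neq0.
have -> : 1 - N * nR ^+ 2 * ((1 - t ^+ 2) / (N * nR ^+ 2)) = t ^+ 2.
  by field; rewrite nR_neq0 N_neq0.
have sum_x : (1 + t) / nR + ((1 - t) / nR + (nR - 2) * (1 / nR)) = 1 by field.
move=> /(_ sum_x); rewrite mulrCA [leRHS]mulrC ler_pM2l // mulrA.
by rewrite ler_pdivrMr // mulrAC -expr2.
Qed.

(** Letting [t] tend to 0 in [admissible_test_point]. *)
Lemma admissible_le (R : realType) (n : nat) (lambda : R) :
  (2 < n)%N -> admissible n lambda -> lambda <= n%:R ^+ 3 / (n%:R - 2).
Proof.
move=> n_gt2 adm.
have n2_gt0 : 0 < n%:R - 2 :> R by rewrite subr_gt0 (ltr_nat R 2).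
have n_gt0 : 0 < n%:R ^+ 2 :> R by rewrite exprn_gt0 // ltr0n (ltn_trans _ n_gt2).
rewrite ler_pdivlMr //; apply/ler_addgt0Pr => e e_gt0.
pose t := Num.min (1 / 2) (e / (4 * n%:R ^+ 2) : R).
have d_gt0 : 0 < 4 * n%:R ^+ 2 :> R by rewrite mulr_gt0.
have t_gt0 : 0 < t by rewrite lt_min !divr_gt0.
have t_le_half : t <= 1 / 2 by rewrite ge_min lexx.
have t_le_e : t * (4 * n%:R ^+ 2) <= e.
  by rewrite -ler_pdivlMr // ge_min lexx orbT.
have t_lt1 : t < 1 by lra.
apply: le_trans (admissible_test_point (ltnW n_gt2) adm t_gt0 t_lt1) _.
(* for t <= 1/2 the excess 2 / (1 - t^2) - 2 = 2 t^2 / (1 - t^2) is at most 4 t *)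
have inv_le : 2 / (1 - t ^+ 2) <= 2 + 4 * t.
  by rewrite ler_pdivrMr; nra.
have -> : n%:R ^+ 3 = n%:R ^+ 2 * n%:R :> R by rewrite -exprSr.
nra.
Qed.

(** An affine condition passes to the supremum whatever the sign of its
    coefficient: a factor [c > 0] preserves least upper bounds, while for
    [c <= 0] the value [sup A * c] lies below every [a * c]. *)
Lemma sup_mul_le (R : realType) (A : set R) (c d : R) :
  has_sup A -> (forall a, A a -> a * c <= d) -> sup A * c <= d.
Proof.
move=> [[a Aa] ubA] le_d; have a_le_sup : a <= sup A by apply: ub_le_sup.
have [c_gt0|c_le0] := ltP 0 c; last first.
  by apply: le_trans (le_d a Aa); rewrite ler_wnM2r.
rewrite -ler_pdivlMr //; apply: ge_sup; first by exists a.
by move=> b Ab; rewrite ler_pdivlMr // le_d.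
Qed.

Lemma admissible_sup (R : realType) (n : nat) :
  (1 < n)%N -> has_sup (@admissible R n) ->
  admissible n (sup (@admissible R n)).
Proof.
move=> n_gt1 supA; have [[a Aa] ubA] := supA.
have sup_gt0 : 0 < sup (@admissible R n).
  by apply: lt_le_trans (ub_le_sup ubA Aa); case: Aa.
split=> //; apply/inequality_holdsP => // x x_gt0 sum_x.
apply: sup_mul_le => // b [b_gt0 /inequality_holdsP ineq_b].
exact: ineq_b.
Qed.

Theorem theorem1 (R : realType) (n : nat) (hn : (2 < n)%N) :
  n%:R ^+ 3 / (n%:R - 1) <= best_constant R n /\
  best_constant R n <= n%:R ^+ 3 / (n%:R - 2).
Proof.
have n_gt1 := ltnW hn.
have adm_low := @admissible_n_cube_div R n n_gt1.
have ubA : has_ubound (@admissible R n).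
  by exists (n%:R ^+ 3 / (n%:R - 2)) => lambda /(admissible_le hn).
have supA : has_sup (@admissible R n).
  by split=> //; exists (n%:R ^+ 3 / (n%:R - 1)).
have max_exists : exists lambda : R,
    admissible n lambda /\ ubound (admissible n) lambda.
  exists (sup (@admissible R n)).
  by split; [exact: admissible_sup | exact: ub_le_sup].
have [adm_best ub_best] := xgetPex 0 max_exists.
by split; [exact: ub_best | exact: admissible_le].
Qed.
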